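(* Let $(\mathbf F,\prec)$ be an IS-family over a finite set $V$. For every integer $x\ge0$, $M(x+1)\le 2M(x)$.
   Context: Let $V$ be a finite set, $n=|V|$, $\mathbf F$ a family of subsets of $V$ and $\prec$ a strict partial order on $\mathbf F$; $S\preceq S'$ means $S\prec S'$ or $S=S'$. For $S\in\mathbf F$ and $v\in V$, $S$ covers $v$ if there is $S'\in\mathbf F$ with $S'\prec S$ and $v\in S'\setminus S$. $Pred(S)$ is the set of $S'\in\mathbf F$ with $S'\prec S$ such that there is no $S''\in\mathbf F$ with $S'\prec S''\prec S$. The visible set $Vis(S)$ is the set of $v\in V$ such that $v\in S'$ for some $S'\in Pred(S)$ and $v$ is not covered by any element of $Pred(S)$. For $S\in\mathbf F$ and $v\in S$, a witness of $v$ w.r.t. $S$ is a $\prec$-minimal element $S'\in\mathbf F$ with $S\prec S'$ and $v\in S\setminus S'$. $(\mathbf F,\prec)$ is an IS-family if: (SE) there is a unique element $sm(\mathbf F)\in\mathbf F$ with $sm(\mathbf F)\prec S$ for every other $S\in\mathbf F$; (SM) $S_1\prec S_2$ implies $|S_1|<|S_2|$; (SW) for every $S\in\mathbf F$ and $v\in S$ there is at most one witness of $v$ w.r.t. $S$; (TE) if $S_1\prec S_2\prec S_3$ are in $\mathbf F$ and $v\in S_1\setminus S_2$ then $v\in S_1\setminus S_3$; (LVS) for every $S\in\mathbf F$ and $S'\in Pred(S)$, $|S'|\le |Vis(S)|$; (DVS) for every $S\in\mathbf F$ with $S\ne sm(\mathbf F)$, $Vis(S)$ is not a subset of $S$; (EC)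 $sm(\mathbf F)$ can be computed in $O(n^3)$ time, for given $S\in\mathbf F$ and $v\in S$ the witness of $v$ w.r.t. $S$ can be computed (or its nonexistence reported) in $O(n^3)$ time, and $S_1\prec S_2$ can be tested in $O(|S_1|)$ time. Notation: $hat(S)=S\setminus\bigcup_{S'\prec S}S'$; $ex(S)=|S|-|sm(\mathbf F)|$; for $x\ge0$, $\mathbf E_x=\{S\in\mathbf F: ex(S)\le x\}$; for $S\in\mathbf E_x$, $hat_x(S)$ is the set of $v\in hat(S)$ such that there is no $S'\in\mathbf E_x$ with $S\prec S'$ and $v\in S\setminus S'$; $M(x)=\sum_{S\in\mathbf E_x}2^{x-ex(S)}|hat_x(S)|$. *)

(* Defs.v *)
From mathcomp Require Import all_boot.
Set Implicit Arguments. Unset Strict Implicit. Unset Printing Implicit Defensive.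

Section ISFamily.
Variable V : finType.
Variable F : {set {set V}}.
Variable prec : rel {set V}.

Definition strict_porder_on : Prop :=
  (forall S, S \in F -> ~~ prec S S) /\
  (forall S1 S2 S3, S1 \in F -> S2 \in F -> S3 \in F ->
     prec S1 S2 -> prec S2 S3 -> prec S1 S3).

Definition covers (S : {set V}) (v : V) : bool :=
  [exists S' in F, prec S' S && (v \in S' :\: S)].

Definition Pred (S : {set V}) : {set {set V}} :=
  [set S' in F | prec S' S &&
     ~~ [exists S'' in F, prec S' S'' && prec S'' S]].

Definition Vis (S : {set V}) : {set V} :=
  [set v | [exists S' in Pred S, v \in S'] &&
           ~~ [exists S' in Pred S, covers S' v]].

Definition witness (S : {set V}) (v : V) (S' : {set V}) : bool :=
  [&& S' \in F, prec S S', v \in S :\: S' &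
      ~~ [exists S'' in F, [&& prec S S'', v \in S :\: S'' & prec S'' S']]].

Definition is_smallest (s : {set V}) : bool :=
  (s \in F) && [forall S in F, (S != s) ==> prec s S].

(* sm(F): the unique smallest element (default set0 if none) *)
Definition sm : {set V} := odflt set0 [pick s | is_smallest s].

Definition IS_family : Prop :=
  strict_porder_on /\
  (exists s, is_smallest s /\ forall s', is_smallest s' -> s' = s) /\
  (forall S1 S2, S1 \in F -> S2 \in F -> prec S1 S2 -> #|S1| < #|S2|) /\
  (forall S v, S \in F -> v \in S -> forall W1 W2,
     witness S v W1 -> witness S v W2 -> W1 = W2) /\
  (forall S1 S2 S3 v, S1 \in F -> S2 \in F -> S3 \in F ->
     prec S1 S2 -> prec S2 S3 -> v \in S1 :\: S2 -> v \in S1 :\: S3) /\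
  (forall S S', S \in F -> S' \in Pred S -> #|S'| <= #|Vis S|) /\
  (forall S, S \in F -> S != sm -> ~~ (Vis S \subset S)).

Definition hat (S : {set V}) : {set V} :=
  S :\: \bigcup_(S' in F | prec S' S) S'.

Definition ex (S : {set V}) : nat := #|S| - #|sm|.

Definition Ex (x : nat) : {set {set V}} := [set S in F | ex S <= x].

Definition hat_x (x : nat) (S : {set V}) : {set V} :=
  [set v in hat S | ~~ [exists S' in Ex x, prec S S' && (v \in S :\: S')]].

Definition M (x : nat) : nat :=
  \sum_(S in Ex x) 2 ^ (x - ex S) * #|hat_x x S|.

End ISFamily.

(* Main.v *)
Require Import Defs.
From mathcomp Require Import all_boot zify.

Set Implicit Arguments.
Unset Strict Implicit.
Unset Printing Implicit Defensive.

(* M(x+1) and 2M(x) share the terms 2^(x+1-ex S) |hat_{x+1} S| with ex S <= x.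
   What is left of 2M(x) weighs each point v of hat_x S \ hat_{x+1} S by
   2^(x+1-ex S); what is left of M(x+1) is |hat_{x+1} W| for the sets W of
   excess x+1.  Such a W is paid for by the points v of Vis W \ W: for the
   smallest predecessor S of W containing v, W is the witness of v w.r.t. S, so
   v lies in hat_x S \ hat_{x+1} S, and by (SW) distinct W give distinct S.
   (DVS) provides one such v, and with (LVS) this bounds
   |hat W| <= |W \ Vis W| by the sum of the weights 2^(|W|-|S|). *)

Lemma leq_sum_subpred (I : finType) (P Q : pred I) (f : I -> nat) :
  (forall i, P i -> Q i) -> \sum_(i | P i) f i <= \sum_(i | Q i) f i.
Proof. exact: (sub_le_big leqnn (fun m n => leq_addr n m)). Qed.

Lemma leq_sum_inj (I J : finType) (A : pred I) (B : pred J) (h : I -> J)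
    (f : J -> nat) :
  {in A &, injective h} -> (forall i, A i -> B (h i)) ->
  \sum_(i | A i) f (h i) <= \sum_(j | B j) f j.
Proof.
move=> h_inj hAB; rewrite -(big_imset _ h_inj) /=.
by apply: leq_sum_subpred => j /imsetP[i Ai ->]; apply: hAB.
Qed.

Lemma leq_sum_exp2 (T : finType) (K : {set T}) (f : T -> nat) v :
  v \in K -> f v + #|K| <= \sum_(w in K) 2 ^ f w.
Proof.
move=> vK; have cardK : #|K| = 1 + \sum_(w in K | w != v) 1.
  by rewrite -sum1_card (bigD1 v).
rewrite (bigD1 v) //= cardK addnA addn1; apply: leq_add; first exact: ltn_expl.
by apply: leq_sum => w _; rewrite expn_gt0.
Qed.

Section ISFamilyTheory.

Variables (V : finType) (F : {set {set V}}) (prec : rel {set V}).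

Local Notation Pred := (Pred F prec).
Local Notation Vis := (Vis F prec).
Local Notation witness := (witness F prec).
Local Notation is_smallest := (is_smallest F prec).
Local Notation sm := (sm F prec).
Local Notation hat := (hat F prec).
Local Notation ex := (ex F prec).
Local Notation Ex := (Ex F prec).
Local Notation hat_x := (hat_x F prec).
Local Notation M := (M F prec).

Lemma Ex_leq y z : y <= z -> {subset Ex y <= Ex z}.
Proof. by move=> yz S; rewrite !inE => /andP[-> /leq_trans->]. Qed.

Lemma mem_hat_x y S v :
  (v \in hat_x y S) =
  (v \in hat S) && ~~ [exists S' in Ex y, prec S S' && (v \in S :\: S')].
Proof. by rewrite /hat_x in_set. Qed.

Lemma hat_x_sub_hat y S : hat_x y S \subset hat S.
Proof. by apply/subsetP => v; rewrite mem_hat_x => /andP[]. Qed.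

Lemma hat_x_succ_subset y S : hat_x y.+1 S \subset hat_x y S.
Proof.
apply/subsetP => v; rewrite !mem_hat_x => /andP[-> /=]; apply: contra.
by case/exists_inP => S' /(Ex_leq (leqnSn y)) S'E sep; apply/exists_inP; exists S'.
Qed.

Lemma M_succ_split x :
  M x.+1 = \sum_(S in Ex x) 2 ^ (x.+1 - ex S) * #|hat_x x.+1 S|
           + \sum_(W in F | ex W == x.+1) #|hat_x x.+1 W|.
Proof.
rewrite /M (bigID (fun S => ex S <= x)) /=; congr (_ + _).
  by apply: eq_bigl => S; rewrite !inE -andbA (andb_idl (@leqW _ _)).
rewrite (eq_bigl (fun W => (W \in F) && (ex W == x.+1))) => [|W].
  by apply: eq_bigr => W /andP[_ /eqP->]; rewrite subnn mul1n.
by rewrite inE -andbA -ltnNge eqn_leq.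
Qed.

Lemma double_M x :
  2 * M x = \sum_(S in Ex x) 2 ^ (x.+1 - ex S) * #|hat_x x.+1 S|
            + \sum_(S in Ex x) \sum_(v in hat_x x S :\: hat_x x.+1 S) 2 ^ (x.+1 - ex S).
Proof.
rewrite /M big_distrr -big_split /=; apply: eq_bigr => S; rewrite inE => /andP[_ exS].
rewrite -(cardsID (hat_x x.+1 S) (hat_x x S)) (setIidPr (hat_x_succ_subset x S)).
by rewrite sum_nat_const subSn // expnS mulnA [#|_| * _]mulnC -mulnDr.
Qed.

Lemma Vis_in_Pred W v : v \in Vis W -> exists2 S, S \in Pred W & v \in S.
Proof. by rewrite inE => /andP[/existsP[S /andP[SP vS]] _]; exists S. Qed.

Lemma in_Pred S W : S \in Pred W -> S \in F /\ prec S W.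
Proof. by rewrite inE => /and3P[]. Qed.

Lemma hat_subset_notVis W : hat W \subset W :\: Vis W.
Proof.
apply/subsetP => v; rewrite /hat !in_setD => /andP[vU ->]; rewrite andbT.
apply: contra vU => /Vis_in_Pred[S /in_Pred[SF SW] vS].
by apply/bigcupP; exists S; rewrite ?SF.
Qed.

(* The smallest predecessor of W containing v (junk value set0 if none). *)
Definition min_pred W v : {set V} :=
  odflt set0 [pick S in F | [&& prec S W, v \in S &
    [forall (S2 | [&& S2 \in F, prec S2 W & v \in S2]), #|S| <= #|S2|]]].

Lemma Vis_not_covers W v T : v \in Vis W -> T \in Pred W -> ~~ covers F prec T v.
Proof. by rewrite inE => /andP[_ /exists_inPn noCov] /noCov. Qed.

Lemma min_predP W v : v \in Vis W ->
  [/\ min_pred W v \in F, prec (min_pred W v) W, v \in min_pred W v &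
      forall S, S \in F -> prec S W -> v \in S -> #|min_pred W v| <= #|S|].
Proof.
move=> /Vis_in_Pred[S0 /in_Pred[S0F S0W] vS0]; rewrite /min_pred; case: pickP => /=.
  move=> S /and4P[SF SW vS /forall_inP minS]; split=> // S2 S2F S2W vS2.
  by apply: minS; rewrite S2F S2W.
move=> noS; pose P := [pred S | [&& S \in F, prec S W & v \in S]].
have PS0 : P S0 by rewrite /= S0F S0W.
case: (@arg_minnP _ S0 P (fun S => #|S|) PS0) => S /and3P[SF SW vS] minS.
have := noS S; rewrite SF SW vS /=; case/negP; apply/forall_inP => S2 PS2.
exact: minS.
Qed.

Hypothesis prec_trans : forall S1 S2 S3, S1 \in F -> S2 \in F -> S3 \in F ->
  prec S1 S2 -> prec S2 S3 -> prec S1 S3.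
Hypothesis card_prec : forall S1 S2, S1 \in F -> S2 \in F ->
  prec S1 S2 -> #|S1| < #|S2|.

Lemma Pred_above S W : S \in F -> W \in F -> prec S W ->
  exists2 T, T \in Pred W & (T == S) || prec S T.
Proof.
move=> SF WF SW; pose P := [pred T | [&& T \in F, prec T W & (T == S) || prec S T]].
have PS : P S by rewrite /= SF SW eqxx.
case: (@arg_maxnP _ S P (fun T => #|T|) PS) => T /and3P[TF TW ST] maxT.
exists T => //; rewrite inE TF TW /=; apply/existsP => -[T2 /and3P[T2F TT2 T2W]].
have ST2 : (T2 == S) || prec S T2.
  apply/orP; right; case/orP: ST => [/eqP<- //|ST]; exact: prec_trans SF TF T2F ST TT2.
by have := maxT T2; rewrite /= T2F T2W ST2 leqNgt (card_prec TF T2F TT2) => /(_ isT).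
Qed.

Lemma witness_below S v S' : S \in F -> S' \in F -> prec S S' -> v \in S :\: S' ->
  exists2 W, witness S v W & (W == S') || prec W S'.
Proof.
move=> SF S'F SS' vSS'.
pose P := [pred T | [&& T \in F, prec S T, v \in S :\: T & (T == S') || prec T S']].
have PS' : P S' by rewrite /= S'F SS' vSS' eqxx.
case: (@arg_minnP _ S' P (fun T => #|T|) PS') => T /and4P[TF ST vST TS'] minT.
exists T => //; rewrite /witness TF ST vST /=.
apply/existsP => -[T2 /andP[T2F /and3P[ST2 vST2 T2T]]].
have T2S' : (T2 == S') || prec T2 S'.
  apply/orP; right; case/orP: TS' => [/eqP<- //|TS']; exact: prec_trans T2F TF S'F T2T TS'.
by have := minT T2; rewrite /= T2F ST2 vST2 T2S' leqNgt (card_prec T2F TF T2T) => /(_ isT).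
Qed.

Hypothesis removal_persists : forall S1 S2 S3 v,
  S1 \in F -> S2 \in F -> S3 \in F ->
  prec S1 S2 -> prec S2 S3 -> v \in S1 :\: S2 -> v \in S1 :\: S3.

Lemma witness_min_pred W v : W \in F -> v \in Vis W :\: W ->
  witness (min_pred W v) v W.
Proof.
move=> WF /setDP[vVis vW]; have [SF SW vS _] := min_predP vVis.
set S := min_pred W v in SF SW vS *.
rewrite /witness WF SW in_setD vW vS /=.
apply/existsP => -[S2 /andP[S2F /and3P[SS2 vSS2 S2W]]].
have /setDP[_ vS2] := vSS2.
have [T TP TS2] := Pred_above S2F WF S2W; have [TF TW] := in_Pred TP.
have vT : v \notin T.
  apply/negP => vT; case/orP: TS2 => [/eqP TS2 | S2T]; first by rewrite -TS2 vT in vS2.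
  by have /setDP[_] := removal_persists SF S2F TF SS2 S2T vSS2; rewrite vT.
have ST : prec S T by case/orP: TS2 => [/eqP-> //|]; exact: prec_trans SF S2F TF SS2.
have /negP := Vis_not_covers vVis TP; apply; apply/existsP; exists S.
by rewrite SF ST in_setD vT vS.
Qed.

Lemma min_pred_in_hat W v : W \in F -> v \in Vis W -> v \in hat (min_pred W v).
Proof.
move=> WF vVis; have [SF SW vS minS] := min_predP vVis.
rewrite /hat in_setD vS andbT; apply/bigcupP => -[S' /andP[S'F S'S] vS'].
have := minS _ S'F (prec_trans S'F SF WF S'S SW) vS'.
by rewrite leqNgt (card_prec S'F SF S'S).
Qed.

Hypothesis witness_uniq : forall S v, S \in F -> v \in S ->
  forall W1 W2, witness S v W1 -> witness S v W2 -> W1 = W2.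

Lemma min_pred_inj v W1 W2 : W1 \in F -> W2 \in F ->
  v \in Vis W1 :\: W1 -> v \in Vis W2 :\: W2 ->
  min_pred W1 v = min_pred W2 v -> W1 = W2.
Proof.
move=> W1F W2F vK1 vK2 eqS; have w1 := witness_min_pred W1F vK1.
have w2 := witness_min_pred W2F vK2; have /setDP[vVis2 _] := vK2.
have [SF _ vS _] := min_predP vVis2; rewrite eqS in w1.
exact (witness_uniq SF vS w1 w2).
Qed.

Lemma Ex_of_card_lt y (S W : {set V}) :
  S \in F -> #|S| < #|W| -> ex W <= y.+1 -> S \in Ex y.
Proof. by move=> SF ltSW; rewrite inE SF /ex; lia. Qed.

Lemma witness_hat_x y S v W : S \in F -> v \in hat S -> witness S v W ->
  ex W = y.+1 -> v \in hat_x y S :\: hat_x y.+1 S.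
Proof.
move=> SF vhat wW exW; have /and4P[WF SW vSW _] := wW.
have /setDP[vS _] := vhat.
rewrite in_setD !mem_hat_x vhat /= negbK; apply/andP; split.
  by apply/existsP; exists W; rewrite inE WF exW leqnn SW vSW.
apply/existsP => -[S' /andP[S'E /andP[SS' vSS']]].
move: S'E; rewrite inE => /andP[S'F exS'].
have [W0 wW0 W0S'] := witness_below SF S'F SS' vSS'.
rewrite (witness_uniq SF vS wW0 wW) in W0S'.
have cardWS' : #|W| <= #|S'|.
  by case/orP: W0S' => [/eqP-> // | /(card_prec WF S'F)/ltnW].
have : ex W <= ex S' := leq_sub2r _ cardWS'.
by rewrite exW => /leq_trans/(_ exS'); rewrite ltnn.
Qed.

Hypothesis has_smallest : exists s, is_smallest s.
Hypothesis card_Pred_le_Vis : forall S S', S \in F -> S' \in Pred S ->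
  #|S'| <= #|Vis S|.
Hypothesis Vis_not_subset : forall S, S \in F -> S != sm -> ~~ (Vis S \subset S).

Lemma card_sm_le S : S \in F -> #|sm| <= #|S|.
Proof.
have /andP[smF /forall_inP smP] : is_smallest sm.
  rewrite /sm; case: pickP => // none; have [s] := has_smallest; by rewrite none.
move=> SF; have [-> // | neq] := eqVneq S sm.
by apply/ltnW/card_prec => //; exact: implyP (smP S SF) neq.
Qed.

Lemma ex_subn S T : S \in F -> ex T - ex S = #|T| - #|S|.
Proof. by move/card_sm_le; rewrite /ex; lia. Qed.

Lemma card_hat_le W : W \in F -> W != sm ->
  #|hat W| <= \sum_(v in Vis W :\: W) 2 ^ (#|W| - #|min_pred W v|).
Proof.
move=> WF Wsm; have /subsetPn[v1 v1Vis v1W] := Vis_not_subset WF Wsm.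
have v1K : v1 \in Vis W :\: W by rewrite in_setD v1W v1Vis.
have [T1 T1P v1T1] := Vis_in_Pred v1Vis; have [T1F T1W] := in_Pred T1P.
have [_ _ _ minS] := min_predP v1Vis.
have le_min_T1 := minS _ T1F T1W v1T1.
have le_T1_Vis := card_Pred_le_Vis WF T1P.
apply: leq_trans (subset_leq_card (hat_subset_notVis W)) _.
apply: leq_trans (leq_sum_exp2 _ v1K).
have := cardsID (Vis W) W; have := cardsID W (Vis W); rewrite setIC; lia.
Qed.

Lemma sum_top_layer_le x :
  \sum_(W in F | ex W == x.+1) #|hat_x x.+1 W| <=
  \sum_(S in Ex x) \sum_(v in hat_x x S :\: hat_x x.+1 S) 2 ^ (x.+1 - ex S).
Proof.
apply: (@leq_trans (\sum_(W in F | ex W == x.+1)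
    \sum_(v in Vis W :\: W) 2 ^ (x.+1 - ex (min_pred W v)))).
  apply: leq_sum => W /andP[WF /eqP exW].
  have Wsm : W != sm by apply: contra_eqN exW => /eqP->; rewrite /ex subnn.
  apply: leq_trans (subset_leq_card (hat_x_sub_hat _ _)) _.
  apply: leq_trans (card_hat_le WF Wsm) (eq_leq _).
  apply: eq_bigr => v /setDP[vVis _]; have [SF _ _ _] := min_predP vVis.
  by rewrite -exW ex_subn.
rewrite (exchange_big_dep predT) //= [leqRHS](exchange_big_dep predT) //=.
apply: leq_sum => v _; apply: leq_sum_inj => [W1 W2 | W].
  rewrite !unfold_in => /andP[/andP[W1F _] vK1] /andP[/andP[W2F _] vK2].
  exact: min_pred_inj.
case/andP=> /andP[WF /eqP exW] vK; have /setDP[vVis _] := vK.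
have [SF SW _ _] := min_predP vVis.
rewrite (Ex_of_card_lt SF (card_prec SF WF SW)) ?exW //=.
exact: witness_hat_x SF (min_pred_in_hat WF vVis) (witness_min_pred WF vK) exW.
Qed.

End ISFamilyTheory.

Theorem lemma3 (V : finType) (F : {set {set V}}) (prec : rel {set V}) :
  IS_family F prec ->
  forall x : nat, M F prec x.+1 <= 2 * M F prec x.
Proof.
move=> [[_ trans] [[s [s_smallest _]] [card_lt [wit_uniq [removal [LVS DVS]]]]]] x.
rewrite M_succ_split double_M leq_add2l.
exact: (sum_top_layer_le trans card_lt removal wit_uniq (ex_intro _ s s_smallest) LVS DVS).
Qed.
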